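(* Let $\mu$ be a finitely supported probability measure on $\mathrm{Homeo}_+(\mathbb{R})$ such that \[ \forall x\in\mathbb{R}\quad \exists f,g\in\operatorname{supp}\mu:\quad g(x)<x<f(x). \] Then, possibly after interchanging $\mu$ and $\hat\mu$ and/or reversing the orientation of $\mathbb{R}$ (i.e. conjugating every map by $x\mapsto -x$, which replaces $f$ by $x\mapsto -f(-x)$), the pair (forward dynamics of $\mu$, inverse dynamics $\hat\mu$) falls into exactly one of the following four classes: \begin{enumerate} \item in the forward dynamics, for every $x$ almost surely $F_n(x)\to+\infty$; in the inverse dynamics, for every $x$ almost surely $\hat F_n(x)\to-\infty$; \item in the forward dynamics, for every $x$ almost surely $F_n(x)\to+\infty$; the inverse dynamics is recurrent; \item both the forward and the inverse dynamics are recurrent; \item in the forward dynamics, for every $x$ almost surely $F_n(x)$ tends to $+\infty$ or to $-\infty$, and each of the events $\{F_n(x)\to+\infty\}$, $\{F_n(x)\to-\infty\}$ has positive probability; the inverse dynamics is recurrent. \end{enumerate}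
   Context: Setup. Let $\mu$ be a probability measure on the group $\mathrm{Homeo}_+(\mathbb{R})$ of orientation-preserving homeomorphisms of $\mathbb{R}$, supported on a finite or countable set $\{f_1,f_2,\dots\}$ with $p_i=\mu(\{f_i\})>0$, $\sum_i p_i=1$. Let $g_1,g_2,\dots$ be i.i.d. random maps with law $\mu$, and set $F_0=\mathrm{id}$, $F_n=g_n\circ\cdots\circ g_1$; this is the forward dynamics (random dynamical system) defined by $\mu$. The inverse (backward) dynamics is the random dynamical system defined by $\hat\mu$, the image of $\mu$ under $f\mapsto f^{-1}$ (so $\hat\mu(\{f^{-1}\})=\mu(\{f\})$); its random compositions are denoted $\hat F_n$. A random dynamical system is called recurrent if there is a compact interval $J\subset\mathbb{R}$ such that for every $x\in\mathbb{R}$, almost surely $F_n(x)\in J$ for infinitely many $n$. *)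

(* Defs.v *)
From HB Require Import structures.
From mathcomp Require Import all_boot all_order all_algebra.
From mathcomp Require Import all_classical all_reals all_analysis.
Set Implicit Arguments. Unset Strict Implicit. Unset Printing Implicit Defensive.
Import Order.TTheory GRing.Theory Num.Theory.
Import numFieldNormedType.Exports.
Local Open Scope classical_set_scope.
Local Open Scope ring_scope.

Section RDS.
Variable R : realType.

Definition homeo_plus (f : R -> R) : Prop :=
  exists g : R -> R, cancel f g /\ cancel g f /\ continuous f /\ continuous g /\
    (forall x y : R, x < y -> f x < f y).

(* the inverse map f^{-1} (meaningful when f is bijective) *)
Definition finv (f : R -> R) : R -> R := fun y => xget 0 [set x | f x = y].

Definition rev_map (f : R -> R) : R -> R := fun x => - f (- x).

(* the transformed family: [s] = interchange mu and mu-hat, [r] = reverse orientation *)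
Definition transf (s r : bool) (k : nat) (fs : 'I_k -> R -> R) : 'I_k -> R -> R :=
  fun i => let g := if s then finv (fs i) else fs i in if r then rev_map g else g.

Definition invfam (k : nat) (fs : 'I_k -> R -> R) : 'I_k -> R -> R :=
  fun i => finv (fs i).

Variables (d : measure_display) (Omega : measurableType d) (P : probability Omega R).

Fixpoint Fn (k : nat) (fs : 'I_k -> R -> R) (xi : nat -> Omega -> 'I_k)
    (n : nat) (w : Omega) (x : R) : R :=
  match n with
  | 0 => x
  | m.+1 => fs (xi m w) (Fn fs xi m w x)
  end.

Definition iid_seq (k : nat) (p : 'I_k -> R) (xi : nat -> Omega -> 'I_k) : Prop :=
  (forall n i, measurable (xi n @^-1` [set i])) /\
  (forall (n : nat) (a : nat -> 'I_k),
     P (\bigcap_(m in `I_n) (xi m @^-1` [set a m])) = (\prod_(m < n) p (a m))%:E).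

Definition to_pinfty (k : nat) (fs : 'I_k -> R -> R) (xi : nat -> Omega -> 'I_k)
    (x : R) (w : Omega) : Prop :=
  (fun n => Fn fs xi n w x) @ \oo --> +oo.

Definition to_minfty (k : nat) (fs : 'I_k -> R -> R) (xi : nat -> Omega -> 'I_k)
    (x : R) (w : Omega) : Prop :=
  (fun n => Fn fs xi n w x) @ \oo --> -oo.

Definition recurrent (k : nat) (fs : 'I_k -> R -> R) (xi : nat -> Omega -> 'I_k) : Prop :=
  exists a b : R, forall x : R,
    {ae P, forall w, forall N : nat, exists2 n : nat, (N <= n)%N &
                     a <= Fn fs xi n w x <= b}.

Definition rds_class (c : nat) (k : nat) (G H : 'I_k -> R -> R)
    (xi : nat -> Omega -> 'I_k) : Prop :=
  match c with
  | 0 => (forall x, {ae P, forall w, to_pinfty G xi x w}) /\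
         (forall x, {ae P, forall w, to_minfty H xi x w})
  | 1 => (forall x, {ae P, forall w, to_pinfty G xi x w}) /\ recurrent H xi
  | 2 => recurrent G xi /\ recurrent H xi
  | 3 => (forall x, {ae P, forall w, to_pinfty G xi x w \/ to_minfty G xi x w}) /\
         (forall x, (0 < P [set w | to_pinfty G xi x w])%E /\
                    (0 < P [set w | to_minfty G xi x w])%E) /\
         recurrent H xi
  | _ => False
  end.

End RDS.

(* Main.v *)
(** Say that the system escapes upwards if, from some starting point, it stays
    nonnegative forever with positive probability.  This is expressed through
    finite-horizon survival probabilities, so that it does not depend on the
    probability space carrying the i.i.d. sequence; escaping downwards means that
    the reversed system escapes upwards.

    Each visit above [a] is followed with probability [p i] by a visit above
    [G i a], hence almost surely limsup and liminf are infinite: an orbit tends to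
    [+oo], tends to [-oo], or oscillates between the two, and in the last case it
    enters a fixed compact interval whenever it crosses [0] downwards.  A system
    that escapes in some direction does not oscillate, and a system that does not
    escape upwards almost surely does not tend to [+oo].  So the behaviour of the
    forward and inverse dynamics is read off from the directions in which they
    escape.

    The remaining combinations are excluded by showing that the forward and inverse
    dynamics cannot escape in the same direction.  By the duality
    [P(Fhat_n y <= z) = P(F_n z >= y)], if the inverse system started at [0] tends
    to [+oo] with probability [e > 0], then the forward survival probabilities are
    at most [1 - e / 2] uniformly in the starting point, whereas they have supremum
    [1] as soon as the forward system escapes upwards. *)

Require Import Defs.
From HB Require Import structures.
From mathcomp Require Import all_boot all_order all_algebra.
From mathcomp Require Import all_classical all_reals all_analysis.
From mathcomp Require Import lra.
Import Order.TTheory GRing.Theory Num.Theory.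
Import numFieldNormedType.Exports.
Local Open Scope classical_set_scope.
Local Open Scope ring_scope.

Set Implicit Arguments.
Unset Strict Implicit.
Unset Printing Implicit Defensive.

(** * Real-valued probabilities and almost sure statements *)

Section RealProbability.
Variables (R : realType) (d : measure_display) (Omega : measurableType d).
Variable P : probability Omega R.

Definition pr (A : set Omega) : R := fine (P A).

Lemma prE (A : set Omega) : measurable A -> P A = (pr A)%:E.
Proof. by move=> mA; rewrite fineK// fin_num_measure. Qed.

Lemma pr_ge0 (A : set Omega) : 0 <= pr A.
Proof. exact/fine_ge0/measure_ge0. Qed.

Lemma prT : pr setT = 1.
Proof. by rewrite /pr probability_setT. Qed.

Lemma pr0 : pr set0 = 0.
Proof. by rewrite /pr measure0. Qed.

Lemma pr_cst (b : bool) : pr [set _ | b] = b%:R.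
Proof.
case: b; first by rewrite (_ : [set _ | _] = setT) ?prT//; apply/seteqP; split.
by rewrite (_ : [set _ | _] = set0) ?pr0//; apply/seteqP; split.
Qed.

Lemma le_pr (A B : set Omega) :
  measurable A -> measurable B -> A `<=` B -> pr A <= pr B.
Proof.
move=> mA mB AB; rewrite -lee_fin -!prE//.
by apply: le_measure; rewrite ?inE.
Qed.

Lemma pr_le1 (A : set Omega) : measurable A -> pr A <= 1.
Proof. by move=> mA; rewrite -prT; apply: le_pr. Qed.

Lemma pr_partition n (A : set Omega) (F : 'I_n -> set Omega) :
  (forall i, measurable (F i)) ->
  (forall i j w, F i w -> F j w -> i = j) ->
  (forall w, A w <-> exists i, F i w) ->
  pr A = \sum_(i < n) pr (F i).
Proof.
move=> mF dF AF.
have -> : A = \big[setU/set0]_(i < n) F i.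
  rewrite -bigcup_seq; apply/seteqP; split => w.
    by move/AF => [i Fi]; exists i => //=; rewrite mem_index_enum.
  by move=> [i _ Fi]; apply/AF; exists i.
rewrite {1}/pr measure_semi_additive_ord//; last 2 first.
- by move=> i j _ _ [w [Fi Fj]]; exact: dF Fi Fj.
- exact: bigsetU_measurable.
rewrite (eq_bigr (fun i => (pr (F i))%:E)) => [|i _]; last exact: prE.
by rewrite sumEFin.
Qed.

Lemma pr_setC (A : set Omega) : measurable A -> pr (~` A) = 1 - pr A.
Proof. by move=> mA; rewrite /pr probability_setC// prE. Qed.

Lemma sum_pr_le1 n (F : 'I_n -> set Omega) :
  (forall i, measurable (F i)) ->
  (forall i j w, F i w -> F j w -> i = j) ->
  \sum_(i < n) pr (F i) <= 1.
Proof.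
move=> mF dF.
have mA : measurable (\bigcup_(i in [set: 'I_n]) F i).
  exact: fin_bigcup_measurable.
rewrite -(@pr_partition _ (\bigcup_(i in [set: 'I_n]) F i))//.
  exact: pr_le1.
by move=> w; split=> [[i _ Fi]|[i Fi]]; exists i.
Qed.

Lemma pr_bigcap_ge (E : nat -> set Omega) (c : R) :
  (forall n, measurable (E n)) -> (forall n, E n.+1 `<=` E n) ->
  (forall n, c <= pr (E n)) -> c <= pr (\bigcap_n E n).
Proof.
move=> mE dE cE.
have mI : measurable (\bigcap_n E n) by exact: bigcapT_measurable.
rewrite -lee_fin -prE//.
have /cvg_lim <- // : (P \o E) n @[n --> \oo] --> P (\bigcap_n E n).
  apply: nonincreasing_cvg_mu => //; first
    by apply: le_lt_trans (probability_le1 P (mE 0%N)) _; exact: ltry.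
  by apply/nonincreasing_seqP => n; apply/subsetPset/dE.
apply: lime_ge; last first.
  by near=> n; have := cE n; rewrite -lee_fin -prE.
apply: ereal_nonincreasing_is_cvgn; apply/nonincreasing_seqP => n /=.
by apply: le_measure; rewrite ?inE.
Unshelve. all: by end_near. Qed.

Lemma ae_not (A : set Omega) :
  measurable A -> pr A = 0 -> {ae P, forall w, ~ A w}.
Proof.
move=> mA A0; exists A; split => //; first by rewrite prE// A0.
by move=> w /contrapT.
Qed.

Lemma ae_False : ~ {ae P, forall w, False}.
Proof.
case=> A [mA A0 TA].
have : P setT = 0.
  apply/eqP; rewrite eq_le measure_ge0 andbT -A0.
  by apply: le_measure; rewrite ?inE// => w _; apply: TA => -[].
by rewrite probability_setT => /eqP; rewrite onee_eq0.
Qed.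

Lemma pr_gt0_ae (A B : set Omega) : measurable A -> measurable B ->
  0 < pr A -> {ae P, forall w, A w -> B w} -> 0 < pr B.
Proof.
move=> mA mB A0 [N [mN N0 AB]].
suff : pr A <= pr B by move/(lt_le_trans A0).
rewrite -lee_fin -!prE//.
have <- : P (B `|` N) = P B by rewrite measureU0.
apply: le_measure; rewrite ?inE//; first exact: measurableU.
move=> w Aw; case: (pselect (B w)); first by left.
by move=> nB; right; apply: AB => /(_ Aw).
Qed.

Lemma borel_cantelli (C : nat -> set Omega) (K : R) :
  (forall n, measurable (C n)) ->
  (forall N, \sum_(n < N) pr (C n) <= K) ->
  {ae P, forall w, exists N, forall n, (N <= n)%N -> ~ C n w}.
Proof.
move=> mC CK.
have L0 : P (lim_sup_set C) = 0.
  apply: lim_sup_set_cvg0 => //; apply: (@le_lt_trans _ _ K%:E); last exact: ltry.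
  apply: lime_le; first by apply: is_cvg_ereal_nneg_natsum.
  near=> N; rewrite big_mkord (eq_bigr (fun i : 'I_N => (pr (C i))%:E)).
    by rewrite sumEFin lee_fin; exact: CK.
  by move=> i _; exact: prE.
exists (lim_sup_set C); split => //.
  by apply: bigcapT_measurable => n; apply: bigcup_measurable.
move=> w /= H n _; apply: contrapT => nC; apply: H; exists n => j nj Cj.
by apply: nC; exists j.
Unshelve. all: by end_near. Qed.

(* The D N n, n <= N, are disjoint and each captures a fixed fraction of C n,
   so the expected number of occurrences of C is at most 1 / delta. *)
Lemma finitely_often (C : nat -> set Omega) (D : nat -> nat -> set Omega) (delta : R) :
  0 < delta ->
  (forall n, measurable (C n)) -> (forall N n, measurable (D N n)) ->
  (forall N n, (n <= N)%N -> delta * pr (C n) <= pr (D N n)) ->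
  (forall N n m w, (n < m)%N -> (m <= N)%N -> D N n w -> ~ D N m w) ->
  {ae P, forall w, exists N, forall n, (N <= n)%N -> ~ C n w}.
Proof.
move=> d0 mC mD CD dD; apply: (@borel_cantelli C delta^-1) => // N.
rewrite -(ler_pM2l d0) divff ?gt_eqF// mulr_sumr.
apply: (@le_trans _ _ (\sum_(n < N) pr (D N n))).
  by apply: ler_sum => n _; apply: CD; exact: ltnW.
apply: sum_pr_le1 => // i j w Di Dj.
case: (ltngtP i j) => [ij|ji|/val_inj//].
- by have := dD N i j w ij (ltnW (ltn_ord j)) Di.
- by have := dD N j i w ji (ltnW (ltn_ord i)) Dj.
Qed.

End RealProbability.

(** * Events determined by finitely many letters, and independence *)

Section Letters.
Variables (R : realType) (d : measure_display) (Omega : measurableType d).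
Variable P : probability Omega R.
Variables (k : nat) (p : 'I_k -> R) (xi : nat -> Omega -> 'I_k).
Hypothesis xi_iid : iid_seq P p xi.

(** Membership depends on the first [n] letters only. This pointwise form stands in for the
    sigma-algebra they generate; measurability is derived from it in [adapted_measurable]. *)
Definition adapted n (C : set Omega) :=
  forall w w', (forall m, (m < n)%N -> xi m w = xi m w') -> C w -> C w'.

Definition letter n (i : 'I_k) : set Omega := xi n @^-1` [set i].

Lemma letter_measurable n i : measurable (letter n i).
Proof. exact: xi_iid.1. Qed.

Lemma pr_letters n (A : set Omega) :
  measurable A -> pr P A = \sum_(i < k) pr P (A `&` letter n i).
Proof.
move=> mA; apply: pr_partition => [i|i j w [_ <-] [_ <-]//|w].
  exact: measurableI (letter_measurable n i).
by split=> [Aw|[i []]//]; exists (xi n w).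
Qed.

Definition cylinder m (a : nat -> 'I_k) : set Omega :=
  \bigcap_(j in `I_m) letter j (a j).

Lemma cylinder_measurable m a : measurable (cylinder m a).
Proof. by apply: fin_bigcap_measurable => [|j _]; [exact: finite_II|exact: letter_measurable]. Qed.

Lemma cylinderS m a j :
  cylinder m a `&` letter m j = cylinder m.+1 (fun n => if n == m then j else a n).
Proof.
apply/seteqP; split => w.
  move=> [aw jw] n /=; rewrite ltnS leq_eqVlt => /orP[/eqP ->|nm].
    by rewrite eqxx.
  by rewrite ltn_eqF//; exact: aw.
move=> aw; split; last by have := aw m (ltnSn m); rewrite eqxx.
move=> n /= nm; have := aw n (leqW nm).
by rewrite ltn_eqF.
Qed.

Lemma pr_cylinder m a : pr P (cylinder m a) = \prod_(j < m) p (a j).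
Proof. by rewrite /pr /cylinder xi_iid.2. Qed.

(** Induction on the number [l] of letters not yet prescribed: splitting along letter [m] lengthens
    the prescribed word by one. Measurability and independence from the next letter are obtained
    together. *)
Lemma adapted_cylinder l m a (C : set Omega) : adapted (m + l) C ->
  measurable (C `&` cylinder m a) /\
  forall i, pr P (C `&` cylinder m a `&` letter (m + l) i) =
            p i * pr P (C `&` cylinder m a).
Proof.
elim: l m a => [|l IH] m a.
  (* With every relevant letter prescribed, [C] either contains the cylinder or misses it. *)
  rewrite addn0 => adC; case: (pselect (exists w, (C `&` cylinder m a) w)).
    move=> [w [Cw aw]].
    have -> : C `&` cylinder m a = cylinder m a.
      apply/seteqP; split=> [w' []//|w' aw']; split => //.
      by apply: adC Cw => j jm; rewrite (aw j jm) (aw' j jm).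
    split=> [|i]; first exact: cylinder_measurable.
    rewrite cylinderS !pr_cylinder big_ord_recr/= eqxx mulrC; congr (_ * _).
    by apply: eq_bigr => j _; rewrite ltn_eqF.
  move=> nC; have -> : C `&` cylinder m a = set0.
    by rewrite -subset0 => w Cw; apply: nC; exists w.
  by split => // i; rewrite set0I pr0 mulr0.
rewrite addnS -addSn => adC.
have mC j : measurable (C `&` cylinder m a `&` letter m j).
  by rewrite -setIA cylinderS; have [] := IH _ (fun n => if n == m then j else a n) adC.
have mCa : measurable (C `&` cylinder m a).
  have -> : C `&` cylinder m a =
      \bigcup_(j in [set: 'I_k]) (C `&` cylinder m a `&` letter m j).
    by apply/seteqP; split=> [w Cw|w [j _ []//]]; exists (xi m w).
  exact: fin_bigcup_measurable.
split=> // i.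
rewrite (pr_letters m); last exact: measurableI (letter_measurable _ _).
rewrite (pr_letters m mCa) mulr_sumr; apply: eq_bigr => j _.
rewrite -setIA (setIC (letter _ _)) setIA -(setIA C) cylinderS.
by have [_ ->] := IH _ (fun n => if n == m then j else a n) adC.
Qed.

Lemma adapted_measurable n (C : set Omega) : adapted n C -> measurable C.
Proof.
move=> adC; case: (pselect (exists w, C w)) => [[w _]|nC].
  (* The empty prefix is used. The infinite word is a placeholder, read off a point of [C] because
     ['I_k] is not known to be inhabited. *)
  have [] := @adapted_cylinder n 0 (xi ^~ w) C adC.
  by rewrite /cylinder bigcap_mkord big_ord0 setIT.
by have -> : C = set0 by rewrite -subset0 => w Cw; apply: nC; exists w.
Qed.

Lemma pr_adapted_letter n (C : set Omega) i :
  adapted n C -> pr P (C `&` letter n i) = p i * pr P C.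
Proof.
move=> adC; have [_ /(_ i)] := @adapted_cylinder n 0 (fun=> i) C adC.
by rewrite /cylinder bigcap_mkord big_ord0 setIT.
Qed.

Lemma adapted_letter n (C : set Omega) i : adapted n C -> adapted n.+1 (C `&` letter n i).
Proof.
move=> adC w w' ww' [Cw iw]; split; last by rewrite /letter/= -ww'.
by apply: adC Cw => m mn; apply: ww'; exact: ltnW.
Qed.

(** One step of the Markov property: [C] is split along letter [n], which is independent of it. In
    use, [E] is the event restarted at time [n.+1] and [c i] bounds its conditional probability
    after letter [i]. *)
Lemma pr_ge_next_letter n (C E F : set Omega) (c : 'I_k -> R) :
  adapted n C -> measurable E -> measurable F -> (forall w, C w -> E w -> F w) ->
  (forall i, c i * pr P (C `&` letter n i) <= pr P (C `&` letter n i `&` E)) ->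
  (\sum_(i < k) p i * c i) * pr P C <= pr P (C `&` F).
Proof.
move=> adC mE mF EF cE; have mC := adapted_measurable adC.
rewrite (pr_letters n (measurableI _ _ mC mF)) mulr_suml; apply: ler_sum => i _.
have mCi : measurable (C `&` letter n i) by exact: measurableI (letter_measurable _ _).
have -> : p i * c i * pr P C = c i * pr P (C `&` letter n i).
  by rewrite (pr_adapted_letter i adC) mulrCA mulrA.
apply: (le_trans (cE i)); apply: le_pr.
- exact: measurableI.
- apply: measurableI (letter_measurable _ _); exact: measurableI.
- by move=> w [[Cw iw] Ew]; split => //; split => //; exact: EF.
Qed.

Lemma pr_le_next_letter n (C E F : set Omega) (c : 'I_k -> R) :
  adapted n C -> measurable E -> measurable F -> (forall w, C w -> F w -> E w) ->
  (forall i, pr P (C `&` letter n i `&` E) <= c i * pr P (C `&` letter n i)) ->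
  pr P (C `&` F) <= (\sum_(i < k) p i * c i) * pr P C.
Proof.
move=> adC mE mF FE cE; have mC := adapted_measurable adC.
rewrite (pr_letters n (measurableI _ _ mC mF)) mulr_suml; apply: ler_sum => i _.
have mCi : measurable (C `&` letter n i) by exact: measurableI (letter_measurable _ _).
have -> : p i * c i * pr P C = c i * pr P (C `&` letter n i).
  by rewrite (pr_adapted_letter i adC) mulrCA mulrA.
apply: le_trans (cE i); apply: le_pr.
- apply: measurableI (letter_measurable _ _); exact: measurableI.
- exact: measurableI.
- by move=> w [[Cw Fw] iw]; split => //; exact: FE.
Qed.

End Letters.

(** * Survival probabilities of the half-line of nonnegative reals *)

Section Survival.
Variables (R : realType) (k : nat) (p : 'I_k -> R) (G : 'I_k -> R -> R).

(* The probability that the walk started at y is nonnegative at times 0, ..., l. *)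
Fixpoint surv l (y : R) : R :=
  if l is l'.+1 then (0 <= y)%R%:R * \sum_(i < k) p i * surv l' (G i y)
  else (0 <= y)%R%:R.

Definition escapes_up := exists y delta : R, 0 < delta /\ forall l, delta <= surv l y.

Hypotheses (p_ge0 : forall i, 0 <= p i) (p_sum : \sum_(i < k) p i = 1).

Lemma surv_ge0 l y : 0 <= surv l y.
Proof.
elim: l y => [|l IH] y /=; first exact: ler0n.
by apply: mulr_ge0; [exact: ler0n | apply: sumr_ge0 => i _; exact: mulr_ge0].
Qed.

Lemma surv_neg l y : y < 0 -> surv l y = 0.
Proof. by case: l => [|l] y0 /=; rewrite leNgt y0//= mul0r. Qed.

Lemma surv_nonneg l y : 0 <= y -> surv l.+1 y = \sum_(i < k) p i * surv l (G i y).
Proof. by move=> /= ->; rewrite mul1r. Qed.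

Lemma survS_le l y : surv l.+1 y <= \sum_(i < k) p i * surv l (G i y).
Proof.
rewrite /= ler_piMl ?lern1 ?leq_b1//.
by apply: sumr_ge0 => i _; rewrite mulr_ge0 ?surv_ge0.
Qed.

Lemma surv_decr l y : surv l.+1 y <= surv l y.
Proof.
elim: l y => [|l IH] y; last first.
  by rewrite /= ler_wpM2l ?ler0n//; apply: ler_sum => i _; rewrite ler_wpM2l//; exact: IH.
rewrite /= ler_piMr ?ler0n// -[leRHS]p_sum; apply: ler_sum => i _.
by rewrite ler_piMr// lern1 leq_b1.
Qed.

Definition surv_lim y := limn (surv ^~ y).

Lemma surv_cvg y : surv ^~ y @ \oo --> surv_lim y.
Proof.
apply: nonincreasing_is_cvgn.
  by apply/nonincreasing_seqP => l; exact: surv_decr.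
by exists 0 => _ [l _ <-]; exact: surv_ge0.
Qed.

Lemma surv_lim_le l y : surv_lim y <= surv l y.
Proof.
apply: (cvgr_to_le (surv_cvg (y:=y))); near=> n.
suff /(_ l n) H : {homo surv ^~ y : n m / (n <= m)%N >-> m <= n}.
  by apply: H; near: n; exact: nbhs_infty_ge.
by apply/nonincreasing_seqP => j; exact: surv_decr.
Unshelve. all: by end_near. Qed.

(** Passage to the limit in [survS_le]. Equality may fail for negative [y], where the left side
    vanishes. *)
Lemma surv_lim_subharmonic y : surv_lim y <= \sum_(i < k) p i * surv_lim (G i y).
Proof.
have h : (fun l => \sum_(i < k) p i * surv l (G i y)) @ \oo -->
    \sum_(i < k) p i * surv_lim (G i y).
  by apply: cvg_big => [|i _]; [exact: add_continuous|apply: cvgMl_tmp; exact: surv_cvg].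
apply: (cvgr_to_ge h); near=> l.
exact: le_trans (surv_lim_le l.+1 y) (survS_le l y).
Unshelve. all: by end_near. Qed.

(* Iterating subharmonicity, surv_lim <= s gives surv_lim <= s * surv l for every l,
   hence surv_lim <= s * surv_lim. *)
Lemma not_escapes_up (s : R) :
  s < 1 -> (forall y, exists l, surv l y <= s) -> ~ escapes_up.
Proof.
move=> s1 survs [y [delta [d0 dy]]].
have lims x : surv_lim x <= s.
  by have [l] := survs x; apply: le_trans; exact: surv_lim_le.
have lim_surv l x : surv_lim x <= s * surv l x.
  elim: l x => [|l IH] x; case: (ltP x 0) => x0;
    try by rewrite surv_neg// mulr0 -(surv_neg 0 x0) surv_lim_le.
  - by rewrite /= x0 mulr1.
  - rewrite surv_nonneg// mulr_sumr; apply: le_trans (surv_lim_subharmonic x) _.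
    by apply: ler_sum => i _; rewrite mulrCA ler_wpM2l.
have : surv_lim y <= s * surv_lim y.
  have h : (fun l => s * surv l y) @ \oo --> s * surv_lim y.
    by apply: cvgMl_tmp; exact: surv_cvg.
  by apply: (cvgr_to_ge h); near=> l; exact: lim_surv.
have : delta <= surv_lim y by apply: (cvgr_to_ge (surv_cvg (y:=y))); near=> l.
nra.
Unshelve. all: by end_near. Qed.

End Survival.

(** * Families of increasing bijections, their inverses and reversals *)

Section Families.
Variables (R : realType) (k : nat).
Implicit Types G : 'I_k -> R -> R.

Definition rev_fam G : 'I_k -> R -> R := fun i => rev_map (G i).

Definition increasing_bijections G := forall i,
  [/\ cancel (G i) (Defs.finv (G i)), cancel (Defs.finv (G i)) (G i) &
      {mono G i : x y / x <= y}].

Definition moves_both_ways G := forall x, exists i j, G j x < x < G i x.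

Lemma finvE (f g : R -> R) : cancel f g -> cancel g f -> Defs.finv f = g.
Proof.
move=> fg gf; apply/funext => y; rewrite /Defs.finv.
by case: xgetP => [x _ <-|/(_ (g y))]; [rewrite fg|case; exact: gf].
Qed.

Lemma homeo_increasing G : (forall i, homeo_plus (G i)) -> increasing_bijections G.
Proof.
move=> homeoG i; have [g [Gg [gG [_ [_ incr]]]]] := homeoG i.
by rewrite (finvE Gg gG); split => //; apply: le_mono => x y /incr.
Qed.

Lemma increasing_inv G : increasing_bijections G -> increasing_bijections (invfam G).
Proof.
move=> incG i; have [Gg gG mG] := incG i.
rewrite /invfam (finvE gG Gg); split => // x y.
by rewrite -mG !gG.
Qed.

Lemma finv_rev G i : increasing_bijections G ->
  Defs.finv (rev_map (G i)) = rev_map (Defs.finv (G i)).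
Proof.
move=> incG; have [Gg gG mG] := incG i.
by apply: finvE => x; rewrite /rev_map opprK ?Gg ?gG opprK.
Qed.

Lemma increasing_rev G : increasing_bijections G -> increasing_bijections (rev_fam G).
Proof.
move=> incG i; have [Gg gG mG] := incG i.
rewrite /rev_fam finv_rev//; split => [x|x|x y]; rewrite /rev_map.
- by rewrite opprK Gg opprK.
- by rewrite opprK gG opprK.
- by rewrite lerN2 mG lerN2.
Qed.

Lemma both_ways_rev G : moves_both_ways G -> moves_both_ways (rev_fam G).
Proof.
move=> bG x; have [i [j /andP[ji ij]]] := bG (- x).
by exists j, i; rewrite /rev_fam /rev_map ltrNl ij ltrNr ji.
Qed.

Lemma both_ways_inv G :
  increasing_bijections G -> moves_both_ways G -> moves_both_ways (invfam G).
Proof.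
move=> incG bG x; have [i [j /andP[jx ix]]] := bG x.
have lt_inv h (y z : R) : (Defs.finv (G h) y < z) = (y < G h z).
  by have [Gg gG mG] := incG h; rewrite !ltNge -mG gG.
have inv_lt h (y z : R) : (z < Defs.finv (G h) y) = (G h z < y).
  by have [Gg gG mG] := incG h; rewrite !ltNge -mG gG.
by exists j, i; rewrite /invfam lt_inv inv_lt jx ix.
Qed.

Lemma invfamK G : increasing_bijections G -> invfam (invfam G) = G.
Proof.
by move=> incG; apply/funext => i; have [Gg gG _] := incG i; exact: finvE.
Qed.

Lemma invfam_rev G : increasing_bijections G -> invfam (rev_fam G) = rev_fam (invfam G).
Proof. by move=> incG; apply/funext => i; exact: finv_rev. Qed.

Lemma rev_famK : involutive rev_fam.
Proof.
by move=> G; apply/funext => i; apply/funext => x; rewrite /rev_fam /rev_map !opprK.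
Qed.

(** If the orbit of [a] under all words were bounded, some [G i] would move its supremum up, and
    would then send orbit points close to the supremum beyond it. *)
Lemma reach_above G : increasing_bijections G -> moves_both_ways G ->
  forall a b : R, exists s : seq 'I_k, b <= foldl (fun x i => G i x) a s.
Proof.
move=> incG bG a b; apply: contrapT => /forallNP nb.
pose orbit := [set foldl (fun x i => G i x) a s | s in [set: seq 'I_k]].
have orbit_sup : has_sup orbit.
  split; first by exists a, [::].
  by exists b => _ [s _ <-]; rewrite leNgt; apply/negP => /ltW; exact: nb.
have [i [_ /andP[_ ltG]]] := bG (sup orbit).
have [Gg gG mG] := incG i.
have lt_sup : Defs.finv (G i) (sup orbit) < sup orbit by rewrite ltNge -mG gG -ltNge.
have [_ [s _ <-] lts] : exists2 x, orbit x & Defs.finv (G i) (sup orbit) < x.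
  have e0 : 0 < sup orbit - Defs.finv (G i) (sup orbit) by rewrite subr_gt0.
  by have [x ox] := sup_adherent e0 orbit_sup; rewrite opprB addrC subrK; exists x.
have : foldl (fun x i => G i x) a (rcons s i) <= sup orbit.
  by apply: ub_le_sup; [exact: orbit_sup.2|exists (rcons s i)].
by rewrite foldl_rcons -[leRHS]gG mG leNgt lts.
Qed.

End Families.

(** * Deterministic facts about real sequences: divergence and crossings *)

Definition infinitely_often (Q : nat -> Prop) := forall N, exists2 n, (N <= n)%N & Q n.

Lemma not_infinitely_often (Q : nat -> Prop) :
  ~ infinitely_often Q -> exists N, forall n, (N <= n)%N -> ~ Q n.
Proof.
move=> /existsNP[N nQ]; exists N => n Nn Qn; apply: nQ; by exists n.
Qed.

Section Paths.
Variable R : realType.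

Lemma cvg_pinftyP (X : nat -> R) :
  X @ \oo --> +oo <-> forall b, exists N, forall n, (N <= n)%N -> b <= X n.
Proof.
rewrite cvgryPge; split=> H b; have := H b.
  by move=> [N _ HN]; exists N => n /HN.
by move=> [N HN]; exists N.
Qed.

Lemma not_cvg_pinfty (X : nat -> R) :
  ~ (X @ \oo --> +oo) -> exists b, infinitely_often (fun n => X n <= b).
Proof.
move=> /cvg_pinftyP/existsNP[b nb]; exists b; apply: contrapT.
move=> /not_infinitely_often[N HN]; apply: nb; exists N => n /HN /negP.
by rewrite -ltNge => /ltW.
Qed.

Lemma infinitely_often_downcross (X : nat -> R) :
  infinitely_often (fun n => 0 <= X n) -> infinitely_often (fun n => X n < 0) ->
  infinitely_often (fun n => 0 <= X n /\ X n.+1 < 0).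
Proof.
move=> up down N; have [n0 Nn0 Xn0] := up N; have [n1 n01 Xn1] := down n0.
have ex : exists n, (n0 <= n)%N && (X n < 0) by exists n1; rewrite n01.
(* The first negative time from [n0] on is the successor of a nonnegative one, since [X n0] is
   nonnegative. *)
case: (ex_minnP ex) => -[|n] /andP[n0n Xn] minn.
  by move: n0n Xn0; rewrite leqn0 => /eqP ->; rewrite leNgt Xn.
move: n0n; rewrite leq_eqVlt => /orP[/eqP n0n|]; first by rewrite leNgt n0n Xn in Xn0.
rewrite ltnS => n0n; exists n; first exact: leq_trans n0n.
split => //; rewrite leNgt; apply/negP => Xn'.
by have := minn n; rewrite n0n Xn' ltnn => /(_ isT).
Qed.

(** Time [n] is the first visit above [y] after some negative value at time [r]. Hence between two
    upcrossings the sequence takes a negative value. *)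
Definition upcrossing (y : R) (X : nat -> R) n :=
  y <= X n /\ exists2 r, (r < n)%N & X r < 0 /\ forall j, (r < j < n)%N -> X j < y.

Lemma infinitely_often_upcrossing (y : R) (X : nat -> R) :
  infinitely_often (fun n => y <= X n) -> infinitely_often (fun n => X n < 0) ->
  infinitely_often (upcrossing y X).
Proof.
move=> up down N; have [r Nr Xr] := down N; have [n1 rn1 Xn1] := up r.+1.
have ex : exists n, (r < n)%N && (y <= X n) by exists n1; rewrite rn1.
case: (ex_minnP ex) => n /andP[rn Xn] minn.
exists n; first exact: leq_trans Nr (ltnW rn).
split => //; exists r => //; split => // j /andP[rj jn].
rewrite ltNge; apply/negP => Xj.
by have := minn j; rewrite rj Xj leqNgt jn => /(_ isT).
Qed.

End Paths.

(** * Almost sure behaviour of one random system *)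

Section Dynamics.
Variables (R : realType) (d : measure_display) (Omega : measurableType d).
Variable P : probability Omega R.
Variables (k : nat) (p : 'I_k -> R) (xi : nat -> Omega -> 'I_k).
Hypothesis xi_iid : iid_seq P p xi.
Hypothesis p_gt0 : forall i, 0 < p i.
Variable G : 'I_k -> R -> R.
Hypotheses (G_inc : increasing_bijections G) (G_both : moves_both_ways G).

Local Notation X x w := (fun n => Fn G xi n w x).

Let G_homo i : {homo G i : x y / x <= y}.
Proof. by move=> x y xy; have [_ _ ->] := G_inc i. Qed.

Lemma Fn_eq n w w' x j : (forall m, (m < n)%N -> xi m w = xi m w') ->
  (j <= n)%N -> Fn G xi j w x = Fn G xi j w' x.
Proof.
move=> ww'; elim: j => //= j IH jn.
by rewrite ww'// IH// ltnW.
Qed.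

Lemma adapted_path n x (Q : (nat -> R) -> Prop) :
  (forall f g, (forall j, (j <= n)%N -> f j = g j) -> Q f -> Q g) ->
  adapted xi n [set w | Q (X x w)].
Proof. by move=> QE w w' ww'; apply: QE => j jn; exact: Fn_eq ww' jn. Qed.

Definition stay x n l : set Omega :=
  [set w | forall j, (n <= j <= n + l)%N -> 0 <= Fn G xi j w x].

Lemma stay_measurable x n l : measurable (stay x n l).
Proof.
apply: (adapted_measurable xi_iid (n := n + l)).
apply: (adapted_path (Q := fun f => forall j, (n <= j <= n + l)%N -> 0 <= f j)).
by move=> f g fg Qf j jn; rewrite -fg ?Qf//; case/andP: jn.
Qed.

(** The maps are increasing, so on [C] the orbit dominates the one restarted from [y] at time [n].
    The event [C] stays general in the induction on the horizon, so that it can be refined by the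
    next letter. *)
Lemma surv_lower l n (C : set Omega) x y : adapted xi n C ->
  (forall w, C w -> y <= Fn G xi n w x) ->
  surv p G l y * pr P C <= pr P (C `&` stay x n l).
Proof.
elim: l n C y => [|l IH] n C y adC Cy; case: (ltP y 0) => y0;
  try by rewrite surv_neg// mul0r pr_ge0.
- rewrite /= y0 mul1r; apply: le_pr.
  + exact: (adapted_measurable xi_iid adC).
  + apply: measurableI; [exact: (adapted_measurable xi_iid adC)|exact: stay_measurable].
  + move=> w Cw; split => // j; rewrite addn0 -eqn_leq => /eqP <-.
    exact: le_trans y0 (Cy w Cw).
- rewrite surv_nonneg//.
  apply: (pr_ge_next_letter xi_iid (E := stay x n.+1 l) adC) => //;
    try exact: stay_measurable.
    move=> w Cw sw j; rewrite leq_eqVlt => /andP[/orP[/eqP <- _|nj jn]].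
      exact: le_trans y0 (Cy w Cw).
    by apply: sw; rewrite nj addSnnS.
  move=> i; apply: IH; first exact: adapted_letter.
  by move=> w [Cw /= <-]; apply: G_homo; exact: Cy.
Qed.

Lemma surv_upper l n (C : set Omega) x y : adapted xi n C ->
  (forall w, C w -> Fn G xi n w x <= y) ->
  pr P (C `&` stay x n l) <= surv p G l y * pr P C.
Proof.
have stay0 l' n' C' y' : y' < 0 -> (forall w, C' w -> Fn G xi n' w x <= y') ->
    C' `&` stay x n' l' = set0.
  move=> y0 Cy; rewrite -subset0 => w [Cw sw].
  by have := sw n'; rewrite leqnn leq_addr leNgt (le_lt_trans (Cy w Cw) y0) => /(_ isT).
elim: l n C y => [|l IH] n C y adC Cy; case: (ltP y 0) => y0;
  try by rewrite (stay0 _ _ _ y)// pr0 surv_neg// mul0r.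
- rewrite /= y0 mul1r; apply: le_pr.
  + apply: measurableI; [exact: (adapted_measurable xi_iid adC)|exact: stay_measurable].
  + exact: (adapted_measurable xi_iid adC).
  + by move=> w [].
- rewrite surv_nonneg//.
  apply: (pr_le_next_letter xi_iid (E := stay x n.+1 l) adC) => //;
    try exact: stay_measurable.
    by move=> w Cw sw j /andP[nj jn]; apply: sw; rewrite ltnW//= -addSnnS.
  move=> i; apply: IH; first exact: adapted_letter.
  by move=> w [Cw /= <-]; apply: G_homo; exact: Cy.
Qed.

(** For fixed [m], consider the times [n] at which the orbit is above [a] without having visited
    [[G i a, +oo)] since time [m]. Reading letter [i] then causes such a visit, so this happens for
    at most one [n], and [finitely_often] applies with fraction [p i]. *)
Lemma ae_climb_letter x a i : {ae P, forall w,
  infinitely_often (fun n => a <= X x w n) ->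
  infinitely_often (fun n => G i a <= X x w n)}.
Proof.
pose C m n := [set w | (m <= n)%N /\ a <= X x w n /\
                       forall j, (m <= j <= n)%N -> X x w j < G i a].
have adC m n : adapted xi n (C m n).
  apply: (adapted_path (Q := fun f => (m <= n)%N /\ a <= f n /\
    forall j, (m <= j <= n)%N -> f j < G i a)) => f g fg [mn [an jn]].
  by split => //; rewrite -fg//; split => // j mj; rewrite -fg ?jn//; case/andP: mj.
have mC m n : measurable (C m n) by exact: (adapted_measurable xi_iid (adC m n)).
suff : {ae P, forall w m, exists N, forall n, (N <= n)%N -> ~ C m n w}.
  apply: filterS => w finC io_a; apply: contrapT => /not_infinitely_often[m HG].
  have [N HN] := finC m; have [n] := io_a (maxn m N).
  rewrite geq_max => /andP[mn Nn] an; apply: (HN n Nn); split => //; split => // j.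
  by move=> /andP[/HG/negP]; rewrite -ltNge.
apply: ae_foralln => m.
apply: (finitely_often (D := fun=> fun n => C m n `&` letter xi n i) (p_gt0 i)) => //.
- by move=> _ n; apply: measurableI => //; exact: (letter_measurable xi_iid).
- by move=> _ n _; rewrite (pr_adapted_letter xi_iid i (adC m n)).
- move=> _ n n' w nn' _ [[mn [an _]] iw] [[_ [_ H]] _].
  have := H n.+1; rewrite nn' (leqW mn) ltNge /= iw => /(_ isT)/negP; apply.
  exact: G_homo.
Qed.

Lemma ae_climb_word x a s : {ae P, forall w,
  infinitely_often (fun n => a <= X x w n) ->
  infinitely_often (fun n => foldl (fun z i => G i z) a s <= X x w n)}.
Proof.
elim: s a => [|i s IH] a /=; first exact: aeW.
apply: filterS2 (ae_climb_letter x a i) (IH (G i a)) => w h1 h2 /h1.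
exact: h2.
Qed.

Lemma ae_climb x : {ae P, forall w, forall a b,
  infinitely_often (fun n => a <= X x w n) ->
  infinitely_often (fun n => b <= X x w n)}.
Proof.
(* Integer levels suffice, which leaves countably many almost sure statements to combine. *)
suff : {ae P, forall w, forall K L : nat,
    infinitely_often (fun n => - K%:R <= X x w n) ->
    infinitely_often (fun n => L%:R <= X x w n)}.
  apply: filterS => w H a b io_a N.
  have /(_ N)[n Nn Hn] : infinitely_often (fun n => (Num.bound `|b|)%:R <= X x w n).
    apply: (H (Num.bound `|a|)) => M; have [n Mn an] := io_a M; exists n => //.
    apply: le_trans an; rewrite lerNl; apply: le_trans (ler_norm _) _.
    by rewrite normrN; exact/ltW/archi_boundP/normr_ge0.
  exists n => //; apply: le_trans Hn; apply: le_trans (ler_norm _) _.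
  exact/ltW/archi_boundP/normr_ge0.
apply: ae_foralln => K; apply: ae_foralln => L.
have [s Ls] := reach_above G_inc G_both (- K%:R) L%:R.
apply: filterS (ae_climb_word x (- K%:R) s) => w H /H {}H N.
by have [n Nn sn] := H N; exists n => //; exact: le_trans sn.
Qed.

Lemma to_pinfty_measurable x : measurable [set w | to_pinfty G xi x w].
Proof.
have -> : [set w | to_pinfty G xi x w] =
    \bigcap_K \bigcup_N \bigcap_(n in [set n | (N <= n)%N]) [set w | K%:R <= X x w n].
  apply/seteqP; split=> w.
    by move=> /cvg_pinftyP H K _; have [N HN] := H K%:R; exists N => // n /HN.
  move=> H; apply/cvg_pinftyP => b; have [N _ HN] := H (Num.bound `|b|) I.
  exists N => n /HN; apply: le_trans; apply: le_trans (ler_norm _) _.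
  exact/ltW/archi_boundP/normr_ge0.
apply: bigcapT_measurable => K; apply: bigcup_measurable => N _.
apply: bigcap_measurable => [|n _]; first by exists N => /=.
apply: (adapted_measurable xi_iid (n := n)).
apply: (adapted_path (Q := fun f => K%:R <= f n)) => f g fg.
by rewrite -fg.
Qed.

(** Each upcrossing of [y] is followed with probability at least [delta] by survival up to the
    horizon [N]. Survival rules out a later upcrossing before [N], so these events are disjoint and
    almost surely there are finitely many upcrossings. *)
Lemma ae_not_oscillating x : escapes_up p G -> {ae P, forall w,
  ~ ((forall b, infinitely_often (fun n => b <= X x w n)) /\
     infinitely_often (fun n => X x w n < 0))}.
Proof.
move=> [y [delta [d0 dy]]]; pose C n := [set w | upcrossing y (X x w) n].
have adC n : adapted xi n (C n).
  apply: (adapted_path (Q := fun f => upcrossing y f n)) => f g fg.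
  move=> [yn [r rn [fr jr]]]; split; first by rewrite -fg.
  exists r => //; split=> [|j /andP[rj jn]]; first by rewrite -fg// ltnW.
  by rewrite -fg ?jr ?rj//; exact: ltnW.
have mC n : measurable (C n) := adapted_measurable xi_iid (adC n).
suff : {ae P, forall w, exists N, forall n, (N <= n)%N -> ~ C n w}.
  apply: filterS => w [N HN] [io_up io_down].
  by have [n /HN] := infinitely_often_upcrossing (io_up y) io_down N.
apply: (finitely_often (D := fun N n => C n `&` stay x n (N - n)) d0) => //.
- by move=> N n; apply: measurableI => //; exact: stay_measurable.
- move=> N n _; apply: le_trans (surv_lower _ (adC n) (y := y) _).
    by rewrite ler_wpM2r ?pr_ge0.
  by move=> w [].
- move=> N n m w nm mN [[yn _] sw] [[_ [r rm [r0 jr]]] _].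
  case: (ltnP r n) => [rn|nr].
    by have := jr n; rewrite rn nm ltNge yn => /(_ isT).
  have := sw r; rewrite nr subnKC ?(leq_trans (ltnW nm))// (leq_trans (ltnW rm))//.
  by rewrite leNgt r0 => /(_ isT).
Qed.

Lemma Fn_bounded n x : exists y, forall w, Fn G xi n w x <= y.
Proof.
elim: n => [|n [y Hy]] /=; first by exists x.
(* The family is finite, so this sum bounds every [G i y] at once. *)
exists (\sum_i `|G i y|) => w; apply: (@le_trans _ _ (G (xi n w) y)).
  exact: G_homo.
apply: le_trans (ler_norm _) _; rewrite (bigD1 (xi n w))//= lerDl.
exact: sumr_ge0.
Qed.

(** An orbit tending to [+oo] is nonnegative from some time [m] on. If this had positive probability
    for some [m], survival from a deterministic upper bound of the position at time [m] would be at
    least as likely at every horizon. *)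
Lemma ae_not_pinfty x : ~ escapes_up p G -> {ae P, forall w, ~ to_pinfty G xi x w}.
Proof.
move=> nup.
suff : {ae P, forall w m, ~ (\bigcap_l stay x m l) w}.
  apply: filterS => w H /cvg_pinftyP/(_ 0)[N HN].
  by apply: (H N) => l _ j /andP[/HN].
apply: ae_foralln => m.
have mS : measurable (\bigcap_l stay x m l).
  by apply: bigcapT_measurable => l; exact: stay_measurable.
apply: ae_not => //; apply/eqP; rewrite eq_le pr_ge0 andbT leNgt.
apply/negP => S0; apply: nup; have [y Hy] := Fn_bounded m x.
exists y, (pr P (\bigcap_l stay x m l)); split => // l.
apply: le_trans (_ : pr P (setT `&` stay x m l) <= _).
  rewrite setTI; apply: le_pr => //; first exact: stay_measurable.
  by move=> w /(_ l I).
by apply: le_trans (surv_upper _ _ (y := y) _) _ => //; rewrite prT mulr1.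
Qed.

Lemma pr_follow_word x s : exists n C, [/\ adapted xi n C, 0 < pr P C &
  forall w, C w -> foldl (fun z i => G i z) x s <= Fn G xi n w x].
Proof.
elim/last_ind: s => [|s i [n [C [adC C0 Cx]]]].
  by exists 0%N, setT; split => //; rewrite prT.
exists n.+1, (C `&` letter xi n i); split.
- exact: adapted_letter.
- by rewrite (pr_adapted_letter xi_iid i adC) mulr_gt0.
- by move=> w [Cw iw]; rewrite foldl_rcons /= iw; apply: G_homo; exact: Cx.
Qed.

(** With positive probability the orbit first follows a fixed word leading above [y] and then stays
    nonnegative forever; transience leaves [+oo] as its only limit. *)
Lemma pr_to_pinfty_gt0 x : escapes_up p G ->
  {ae P, forall w, to_pinfty G xi x w \/ to_minfty G xi x w} ->
  0 < pr P [set w | to_pinfty G xi x w].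
Proof.
move=> [y [delta [d0 dy]]] transient.
have [s ys] := reach_above G_inc G_both x y.
have [n [C [adC C0 Cx]]] := pr_follow_word x s.
have mC := adapted_measurable xi_iid adC.
have mE l : measurable (C `&` stay x n l).
  by apply: measurableI => //; exact: stay_measurable.
apply: (@pr_gt0_ae _ _ _ P (\bigcap_l (C `&` stay x n l))).
- exact: bigcapT_measurable.
- exact: to_pinfty_measurable.
- apply: (@lt_le_trans _ _ (delta * pr P C)); first exact: mulr_gt0.
  apply: pr_bigcap_ge => // l.
    move=> w [Cw sw]; split => // j /andP[nj jn]; apply: sw.
    by rewrite nj (leq_trans jn)// leq_add2l.
  apply: le_trans (surv_lower l adC (y := y) _).
    by rewrite ler_wpM2r ?pr_ge0.
  by move=> w Cw; exact: le_trans (Cx w Cw).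
- apply: filterS transient => w [//|/cvgrNyPle/(_ (-1))[N _ HN]] sw.
  have [_ /(_ (maxn n N))] := sw (maxn n N) I.
  rewrite leq_maxl leq_addl => /(_ isT).
  have := HN (maxn n N) (leq_maxr _ _) => /= h1 h2.
  by have := le_trans h2 h1; rewrite lerNr oppr0 ler10.
Qed.

End Dynamics.

(** * Both ends of the line: trichotomy, transience and recurrence *)

Section TwoSided.
Variables (R : realType) (d : measure_display) (Omega : measurableType d).
Variable P : probability Omega R.
Variables (k : nat) (p : 'I_k -> R) (xi : nat -> Omega -> 'I_k).
Hypothesis xi_iid : iid_seq P p xi.
Hypothesis p_gt0 : forall i, 0 < p i.

Lemma Fn_rev (G : 'I_k -> R -> R) n w x : Fn (rev_fam G) xi n w (- x) = - Fn G xi n w x.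
Proof. by elim: n => //= n ->; rewrite /rev_fam /rev_map opprK. Qed.

Lemma to_minfty_rev (G : 'I_k -> R -> R) x w :
  to_minfty G xi x w <-> to_pinfty (rev_fam G) xi (- x) w.
Proof.
rewrite /to_minfty /to_pinfty -cvgNry.
by under [X in _ <-> (X @ _ --> _)]funext do rewrite Fn_rev.
Qed.

Lemma to_minfty_measurable (G : 'I_k -> R -> R) x :
  measurable [set w | to_minfty G xi x w].
Proof.
have -> : [set w | to_minfty G xi x w] = [set w | to_pinfty (rev_fam G) xi (- x) w].
  by apply/seteqP; split => w /to_minfty_rev.
exact: to_pinfty_measurable xi_iid _ _.
Qed.

Variable G : 'I_k -> R -> R.
Hypotheses (G_inc : increasing_bijections G) (G_both : moves_both_ways G).

Local Notation X x w := (fun n => Fn G xi n w x).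

(** An orbit not tending to [+oo] is infinitely often below some level, hence below every level by
    [ae_climb] for the reversed system; symmetrically at the other end. *)
Lemma ae_trichotomy x : {ae P, forall w, to_pinfty G xi x w \/ to_minfty G xi x w \/
  (forall b, infinitely_often (fun n => b <= X x w n)) /\
  (forall b, infinitely_often (fun n => X x w n <= b))}.
Proof.
have climb := ae_climb xi_iid p_gt0 G_inc G_both x.
have fall := ae_climb xi_iid p_gt0 (increasing_rev G_inc) (both_ways_rev G_both) (- x).
apply: filterS2 climb fall => w up down.
case: (pselect (to_pinfty G xi x w)) => [|/not_cvg_pinfty[b io_b]]; first by left.
case: (pselect (to_minfty G xi x w)) => [|]; first by right; left.
rewrite to_minfty_rev => /not_cvg_pinfty[a io_a].
right; right; split=> c.
  apply: (up (- a)) => N; have [n Nn] := io_a N; exists n => //.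
  by rewrite lerNl -Fn_rev.
move=> N; have [|n Nn] := down (- b) (- c) _ N.
  by move=> M; have [n Mn Xb] := io_b M; exists n; rewrite ?Fn_rev ?lerN2.
by rewrite Fn_rev lerN2 => cn; exists n.
Qed.

Lemma ae_transient x : escapes_up p G \/ escapes_up p (rev_fam G) ->
  {ae P, forall w, to_pinfty G xi x w \/ to_minfty G xi x w}.
Proof.
have io_neg (Y : nat -> R) : (forall b, infinitely_often (fun n => Y n <= b)) ->
    infinitely_often (fun n => Y n < 0).
  move=> io N; have [n Nn Yn] := io (-1) N; exists n => //.
  by apply: le_lt_trans Yn _; rewrite oppr_lt0.
case=> up.
  apply: filterS2 (ae_trichotomy x) (ae_not_oscillating xi_iid G_inc x up).
  move=> w [|[|[io_up io_down]]] nosc; [by left|by right|exfalso].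
  by apply: nosc; split => //; exact: io_neg.
have := ae_not_oscillating xi_iid (increasing_rev G_inc) (- x) up.
apply: filterS2 (ae_trichotomy x) => w [|[|[io_up io_down]]] nosc; [by left|by right|].
exfalso; apply: nosc; split=> [b N|].
  have [n Nn nb] := io_down (- b) N; exists n => //.
  by rewrite Fn_rev lerNr.
apply: io_neg => b N; have [n Nn nb] := io_up (- b) N; exists n => //.
by rewrite Fn_rev lerNl.
Qed.

Lemma not_escaping_recurrent :
  ~ escapes_up p G -> ~ escapes_up p (rev_fam G) -> recurrent P G xi.
Proof.
(* A step from a nonnegative to a negative point by the map [G i] lands in [[G i 0, 0]]; the
   interval contains all of these. *)
move=> nup ndown; exists (- \sum_i `|G i 0|), 0 => x.
have nm := ae_not_pinfty xi_iid (increasing_rev G_inc) (- x) ndown.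
apply: filterS3 (ae_trichotomy x) (ae_not_pinfty xi_iid G_inc x nup) nm.
move=> w [//|[/to_minfty_rev//|[io_up io_down]]] _ _ N.
have io_neg : infinitely_often (fun n => X x w n < 0).
  move=> M; have [n Mn Yn] := io_down (-1) M; exists n => //.
  by apply: le_lt_trans Yn _; rewrite oppr_lt0.
have [n Nn [Xn Xn1]] := infinitely_often_downcross (io_up 0) io_neg N.
exists n.+1; first exact: leqW.
rewrite (ltW Xn1) andbT /= lerNl; have [_ _ mG] := G_inc (xi n w).
apply: (@le_trans _ _ (- G (xi n w) 0)); first by rewrite lerN2 mG.
apply: le_trans (ler_norm _) _; rewrite normrN (bigD1 (xi n w))//= lerDl.
exact: sumr_ge0.
Qed.

Lemma escaping_pr_gt0 x : escapes_up p G -> 0 < pr P [set w | to_pinfty G xi x w].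
Proof.
move=> up; apply: (pr_to_pinfty_gt0 xi_iid p_gt0 G_inc G_both up).
by apply: ae_transient; left.
Qed.

Lemma ae_to_pinfty x : escapes_up p G -> ~ escapes_up p (rev_fam G) ->
  {ae P, forall w, to_pinfty G xi x w}.
Proof.
move=> up ndown.
have nm := ae_not_pinfty xi_iid (increasing_rev G_inc) (- x) ndown.
apply: filterS2 (ae_transient x (or_introl up)) nm.
by move=> w [//|/to_minfty_rev].
Qed.

End TwoSided.

(** * Duality between forward and inverse dynamics *)

Section Duality.
Variables (R : realType) (d : measure_display) (Omega : measurableType d).
Variable P : probability Omega R.
Variables (k : nat) (p : 'I_k -> R) (xi : nat -> Omega -> 'I_k).
Hypothesis xi_iid : iid_seq P p xi.
Variable G : 'I_k -> R -> R.
Hypothesis G_inc : increasing_bijections G.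

Lemma pr_last_letter n (A : 'I_k -> set Omega) : (forall i, adapted xi n (A i)) ->
  pr P [set w | A (xi n w) w] = \sum_(i < k) p i * pr P (A i).
Proof.
move=> adA.
rewrite (@pr_partition _ _ _ P k _ (fun i => A i `&` letter xi n i)).
- by apply: eq_bigr => i _; rewrite (pr_adapted_letter xi_iid i (adA i)).
- move=> i; apply: measurableI; first exact: (adapted_measurable xi_iid (adA i)).
  exact: (letter_measurable xi_iid).
- by move=> i j w [_ <-] [_ <-].
- by move=> w; split=> [Aw|[i [Aw /= ->]]//]; exists (xi n w).
Qed.

(** The two operators peel off the last map applied: [push_target] in the event that the forward
    orbit of [z] is above [y], [push_source] in the event that the inverse orbit of [y] is below
    [z]. *)
Definition push_target (Q : R -> R -> R) z y := \sum_(i < k) p i * Q z (Defs.finv (G i) y).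
Definition push_source (Q : R -> R -> R) z y := \sum_(i < k) p i * Q (G i z) y.
Let above (z y : R) : R := (y <= z)%R%:R.

(** The operators commute, acting on different variables, and they agree on [above] because [G i] is
    increasing. *)
Lemma iter_push n : iter n push_target above = iter n push_source above.
Proof.
have commute Q : push_target (push_source Q) = push_source (push_target Q).
  apply/funext => z; apply/funext => y; rewrite /push_target /push_source.
  under eq_bigr do rewrite mulr_sumr.
  rewrite exchange_big /=; apply: eq_bigr => i _; rewrite mulr_sumr.
  by apply: eq_bigr => j _; rewrite mulrCA.
have commute_iter m Q :
    push_target (iter m push_source Q) = iter m push_source (push_target Q).
  by elim: m => //= m IH; rewrite commute IH.
elim: n => // n IH; rewrite iterS IH commute_iter iterSr; congr (iter n _ _).
apply/funext => z; apply/funext => y; apply: eq_bigr => i _.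
by have [_ gG mG] := G_inc i; rewrite /above -mG gG.
Qed.

Lemma pr_above n z y : pr P [set w | y <= Fn G xi n w z] = iter n push_target above z y.
Proof.
elim: n y => [|n IH] y.
  exact: (pr_cst P (y <= z)).
rewrite iterS /push_target; under eq_bigr do rewrite -IH.
rewrite -(@pr_last_letter n (fun i => [set w | Defs.finv (G i) y <= Fn G xi n w z])).
  congr (pr P _); apply/seteqP; split => w /=;
  by have [_ gG mG] := G_inc (xi n w); rewrite -(mG (Defs.finv _ _)) gG.
move=> i; apply: (adapted_path (Q := fun f => Defs.finv (G i) y <= f n)) => f g fg.
by rewrite -fg.
Qed.

Lemma pr_inv_below n z y :
  pr P [set w | Fn (invfam G) xi n w y <= z] = iter n push_source above z y.
Proof.
elim: n z => [|n IH] z.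
  exact: (pr_cst P (y <= z)).
rewrite iterS /push_source; under eq_bigr do rewrite -IH.
rewrite -(@pr_last_letter n (fun i => [set w | Fn (invfam G) xi n w y <= G i z])).
  congr (pr P _); apply/seteqP; split => w /=;
  by have [_ gG mG] := G_inc (xi n w); rewrite /invfam -(mG (Defs.finv _ _)) gG.
move=> i; apply: (adapted_path (Q := fun f => f n <= G i z)) => f g fg.
by rewrite -fg.
Qed.

Lemma duality n z y : pr P [set w | Fn (invfam G) xi n w y <= z] =
                      pr P [set w | y <= Fn G xi n w z].
Proof. by rewrite pr_inv_below pr_above iter_push. Qed.

End Duality.

(** * Forward and inverse dynamics do not escape in the same direction *)

Section Exclusion.
Variables (R : realType) (d : measure_display) (Omega : measurableType d).
Variable P : probability Omega R.
Variables (k : nat) (p : 'I_k -> R) (xi : nat -> Omega -> 'I_k).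
Hypothesis xi_iid : iid_seq P p xi.
Hypotheses (p_gt0 : forall i, 0 < p i) (p_sum : \sum_(i < k) p i = 1).
Variable G : 'I_k -> R -> R.
Hypotheses (G_inc : increasing_bijections G) (G_both : moves_both_ways G).

Lemma not_escapes_up_inv : escapes_up p G -> ~ escapes_up p (invfam G).
Proof.
move=> up up'; set H := invfam G.
have H_inc : increasing_bijections H := increasing_inv G_inc.
have H_both : moves_both_ways H := both_ways_inv G_inc G_both.
have e0 := escaping_pr_gt0 xi_iid p_gt0 H_inc H_both 0 up'.
set e := pr P _ in e0.
have mH n z : measurable [set w | Fn H xi n w 0 <= z].
  apply: (adapted_measurable xi_iid (n := n)).
  by apply: (adapted_path (Q := fun f => f n <= z)) => f g fg; rewrite -fg.
have mT := to_pinfty_measurable xi_iid H 0.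
(* Otherwise the inverse orbit of [0] is below [z] infinitely often with probability at least
   [1 - e / 2], although that event is disjoint from divergence to [+oo], of probability [e]. *)
have half z : exists n, pr P [set w | Fn H xi n w 0 <= z] <= 1 - e / 2.
  apply: contrapT => /forallNP nz.
  pose U m := \bigcup_(n in [set n | (m <= n)%N]) [set w | Fn H xi n w 0 <= z].
  have mU m : measurable (U m) by apply: bigcup_measurable.
  have : 1 - e / 2 <= pr P (\bigcap_m U m).
    apply: pr_bigcap_ge => // [m w [n mn zn]|m]; first by exists n => //; exact: ltnW.
    apply: (@le_trans _ _ (pr P [set w | Fn H xi m w 0 <= z])).
      by rewrite leNgt; apply/negP => /ltW; exact: nz.
    by apply: le_pr => // w zw; exists m => //=.
  have : pr P (\bigcap_m U m) <= 1 - e.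
    rewrite -pr_setC//; apply: le_pr; [exact: bigcapT_measurable|exact: measurableC|].
    move=> w Uw /cvg_pinftyP/(_ (z + 1))[N HN].
    have [n Nn zn] := Uw N I; have := le_trans (HN n Nn) zn.
    by rewrite gerDl ler10.
  by move: e0; lra.
apply: (@not_escapes_up R k p G (fun i => ltW (p_gt0 i)) p_sum (1 - e / 2)) up.
  by move: e0; lra.
move=> z; have [n zn] := half z; exists n; apply: le_trans zn.
(* By duality the bound is on the probability that the forward orbit of [z] is nonnegative at time
   [n], which survival up to time [n] implies. *)
rewrite (duality xi_iid G_inc) -[leLHS]mulr1 -(prT P).
apply: le_trans (surv_lower xi_iid G_inc n (n := 0%N) (x := z) _ _) _ => //.
apply: le_pr.
- by rewrite setTI; exact: (stay_measurable xi_iid).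
- apply: (adapted_measurable xi_iid (n := n)).
  by apply: (adapted_path (Q := fun f => 0 <= f n)) => f g fg; rewrite -fg.
- by move=> w [_ sw]; apply: sw; rewrite leq0n add0n /=.
Qed.

End Exclusion.

(** * From escape directions to the four classes, and their exclusiveness *)

Section Classes.
Variables (R : realType) (k : nat) (p : 'I_k -> R).

(** The four classes in terms of [p] and [G] alone, so that the class does not vary with the
    probability space. *)
Definition escape_pattern (c : nat) (G : 'I_k -> R -> R) : Prop :=
  let up := escapes_up p G in let down := escapes_up p (rev_fam G) in
  let up' := escapes_up p (invfam G) in let down' := escapes_up p (rev_fam (invfam G)) in
  match c with
  | 0 => [/\ up, ~ down, ~ up' & down']
  | 1 => [/\ up, ~ down, ~ up' & ~ down']
  | 2 => [/\ ~ up, ~ down, ~ up' & ~ down']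
  | 3 => [/\ up, down, ~ up' & ~ down']
  | _ => False
  end.

Variables (d : measure_display) (Omega : measurableType d) (P : probability Omega R).
Variable xi : nat -> Omega -> 'I_k.
Hypothesis xi_iid : iid_seq P p xi.

Lemma rds_class_of_pattern c (G : 'I_k -> R -> R) :
  (forall i, 0 < p i) -> increasing_bijections G -> moves_both_ways G ->
  escape_pattern c G -> rds_class P c G (invfam G) xi.
Proof.
move=> p_gt0 incG bG.
have incH := increasing_inv incG; have bH := both_ways_inv incG bG.
have incr := increasing_rev incG; have br := both_ways_rev bG.
have incrH := increasing_rev incH; have brH := both_ways_rev bH.
case: c => [|[|[|[|//]]]] /= [up down up' down'].
- split=> x; first exact: (ae_to_pinfty xi_iid p_gt0).
  have : {ae P, forall w, to_pinfty (rev_fam (invfam G)) xi (- x) w}.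
    by apply: (ae_to_pinfty xi_iid p_gt0) => //; rewrite rev_famK.
  by apply: filterS => w /to_minfty_rev.
- split=> [x|]; first exact: (ae_to_pinfty xi_iid p_gt0).
  exact: (not_escaping_recurrent xi_iid p_gt0).
- by split; exact: (not_escaping_recurrent xi_iid p_gt0).
- split=> [x|]; first by apply: (ae_transient xi_iid p_gt0) => //; left.
  split=> [x|]; last exact: (not_escaping_recurrent xi_iid p_gt0).
  split.
    rewrite prE; last exact: (to_pinfty_measurable xi_iid).
    by rewrite lte_fin; exact: (escaping_pr_gt0 xi_iid p_gt0).
  rewrite prE; last exact: (to_minfty_measurable xi_iid).
  rewrite lte_fin (_ : [set w | _] = [set w | to_pinfty (rev_fam G) xi (- x) w]).
    exact: (escaping_pr_gt0 xi_iid p_gt0).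
  by apply/seteqP; split => w /to_minfty_rev.
Qed.

Lemma transient_not_recurrent (G : 'I_k -> R -> R) :
  (forall x, {ae P, forall w, to_pinfty G xi x w \/ to_minfty G xi x w}) ->
  ~ recurrent P G xi.
Proof.
move=> tr [a [b rec]]; apply: (@ae_False _ _ _ P).
apply: filterS2 (tr 0) (rec 0) => w [/cvgryPge/(_ (b + 1))|/cvgrNyPle/(_ (a - 1))];
  move=> [N _ HN] /(_ N)[n Nn /andP[an nb]]; have := HN n Nn => /= Hn; lra.
Qed.

Lemma ae_pinfty_not_minfty (G : 'I_k -> R -> R) x :
  {ae P, forall w, to_pinfty G xi x w} -> ~ (0 < P [set w | to_minfty G xi x w])%E.
Proof.
move=> top; have mm := to_minfty_measurable xi_iid G x.
rewrite prE// lte_fin => /(@pr_gt0_ae _ _ _ P _ set0 mm measurable0).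
rewrite pr0 ltxx => H; suff : false by []; apply: H.
apply: filterS top => w /cvgryPge/(_ 1)[N _ HN] /cvgrNyPle/(_ 0)[M _ HM].
have h1 := HN (maxn N M) (leq_maxl _ _); have h2 := HM (maxn N M) (leq_maxr _ _).
by move: (le_trans h1 h2); rewrite ler10.
Qed.

(** Recurrence of [G] singles out class 2, a positive probability of tending to [-oo] separates
    class 3 from 0 and 1, and recurrence of [H] separates 1 from 0. *)
Lemma rds_class_unique c c' (G H : 'I_k -> R -> R) :
  rds_class P c G H xi -> rds_class P c' G H xi -> c' = c.
Proof.
have up_trans : (forall x, {ae P, forall w, to_pinfty G xi x w}) ->
    forall x, {ae P, forall w, to_pinfty G xi x w \/ to_minfty G xi x w}.
  by move=> top x; apply: filterS (top x) => w; left.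
have down_trans : (forall x, {ae P, forall w, to_minfty H xi x w}) ->
    forall x, {ae P, forall w, to_pinfty H xi x w \/ to_minfty H xi x w}.
  by move=> tom x; apply: filterS (tom x) => w; right.
have not01 : rds_class P 0 G H xi -> ~ rds_class P 1 G H xi.
  by move=> [_ /down_trans/transient_not_recurrent nrec] [_ /nrec].
have not_rec c1 : (c1 != 2)%N -> rds_class P c1 G H xi -> ~ recurrent P G xi.
  case: c1 => [|[|[|[|]]]]//= _ [].
  - by move=> /up_trans/transient_not_recurrent.
  - by move=> /up_trans/transient_not_recurrent.
  - by move=> /transient_not_recurrent.
have not3 : (forall x, {ae P, forall w, to_pinfty G xi x w}) -> ~ rds_class P 3 G H xi.
  by move=> top [_ [/(_ 0)[_ m0] _]]; exact: ae_pinfty_not_minfty (top 0) m0.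
move=> hc hc'.
case: (eqVneq c 2%N) (not_rec c) => [c2 _|_ /(_ isT hc) nr];
case: (eqVneq c' 2%N) (not_rec c') => [c2' _|_ /(_ isT hc') nr'].
- by rewrite c2 c2'.
- by move: hc; rewrite c2 => -[/nr'].
- by move: hc'; rewrite c2' => -[/nr].
move: hc hc' nr nr' {not_rec}.
case: c => [|[|[|[|//]]]]; case: c' => [|[|[|[|//]]]] //;
  try (by move=> [rG _] _ /(_ rG)); try (by move=> _ [rG _] /(_ rG)).
- by move=> h0 /(not01 h0).
- by move=> [/not3].
- by move=> h1 /not01/(_ h1).
- by move=> [/not3].
- by move=> h3 [/not3/(_ h3)].
- by move=> h3 [/not3/(_ h3)].
Qed.

End Classes.

(** * Normalisation by interchange and reversal, and conclusion *)

(** Of the sixteen combinations of escape directions, the two exclusions leave nine, each brought to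
    one of the four patterns by a suitable [s] and [r]. *)
Lemma escape_pattern_cases (R : realType) (k : nat) (p : 'I_k -> R) (G : 'I_k -> R -> R) :
  increasing_bijections G ->
  ~ (escapes_up p G /\ escapes_up p (invfam G)) ->
  ~ (escapes_up p (rev_fam G) /\ escapes_up p (rev_fam (invfam G))) ->
  exists (s r : bool) (c : nat), (c < 4)%N /\ escape_pattern p c (transf s r G).
Proof.
move=> incG uu dd; have incH := increasing_inv incG.
have EFF : transf false false G = G by [].
have ETF : transf true false G = invfam G by [].
have EFT : transf false true G = rev_fam G by [].
have ETT : transf true true G = rev_fam (invfam G) by [].
have IR := invfam_rev incG; have IRI := invfam_rev incH; have II := invfamK incG.
case: (pselect (escapes_up p G)) => u; case: (pselect (escapes_up p (rev_fam G))) => dn;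
case: (pselect (escapes_up p (invfam G))) => u';
case: (pselect (escapes_up p (rev_fam (invfam G)))) => dn';
try (by case: uu); try (by case: dd).
- by exists false, false, 3%N.
- by exists false, false, 0%N.
- by exists false, false, 1%N.
- by exists false, true, 0%N; rewrite EFT /escape_pattern IR !rev_famK.
- by exists false, true, 1%N; rewrite EFT /escape_pattern IR !rev_famK.
- by exists true, false, 3%N; rewrite ETF /escape_pattern II.
- by exists true, false, 1%N; rewrite ETF /escape_pattern II.
- by exists true, true, 1%N; rewrite ETT /escape_pattern IRI II !rev_famK.
- by exists false, false, 2%N.
Qed.

Lemma transf_increasing (R : realType) (k : nat) (G : 'I_k -> R -> R) s r :
  increasing_bijections G -> increasing_bijections (transf s r G).
Proof.
move=> incG; have incH := increasing_inv incG.
by case: s; case: r => //; exact: increasing_rev.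
Qed.

Lemma transf_both_ways (R : realType) (k : nat) (G : 'I_k -> R -> R) s r :
  increasing_bijections G -> moves_both_ways G -> moves_both_ways (transf s r G).
Proof.
move=> incG bG; have bH := both_ways_inv incG bG.
by case: s; case: r => //; exact: both_ways_rev.
Qed.

Theorem theorem1 (R : realType) (k : nat) (fs : 'I_k -> R -> R) (p : 'I_k -> R)
  (Hhomeo : forall i, homeo_plus (fs i))
  (Hpos : forall i, 0 < p i)
  (Hsum : \sum_(i < k) p i = 1)
  (Hsupp : forall x : R, exists i j : 'I_k, fs j x < x < fs i x) :
  exists (s r : bool) (c : nat),
    (c < 4)%N /\
    (forall (d : measure_display) (Omega : measurableType d) (P : probability Omega R)
            (xi : nat -> Omega -> 'I_k),
       iid_seq P p xi ->
       rds_class P c (transf s r fs) (invfam (transf s r fs)) xi) /\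
    (forall (d : measure_display) (Omega : measurableType d) (P : probability Omega R)
            (xi : nat -> Omega -> 'I_k) (c' : nat),
       iid_seq P p xi ->
       rds_class P c' (transf s r fs) (invfam (transf s r fs)) xi -> c' = c).
Proof.
have incG := homeo_increasing Hhomeo.
(* The exclusion is proved through an i.i.d. sequence, while [c] must be chosen before one is given.
   In the excluded cases an arbitrary class is named, and any i.i.d. sequence then yields a
   contradiction. *)
have [up|nup] := pselect (escapes_up p fs /\ escapes_up p (invfam fs)).
  exists false, false, 0%N; split => //.
  by split=> d Omega P xi => [|c'] iid;
    have := not_escapes_up_inv iid Hpos Hsum incG Hsupp up.1 up.2.
have [down|ndown] := pselect (escapes_up p (rev_fam fs) /\
                              escapes_up p (rev_fam (invfam fs))).
  exists false, false, 0%N; split => //.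
  have := down.2; rewrite -invfam_rev// => down2.
  by split=> d Omega P xi => [|c'] iid;
    have := not_escapes_up_inv iid Hpos Hsum (increasing_rev incG)
      (both_ways_rev Hsupp) down.1 down2.
have [s [r [c [c4 pat]]]] := escape_pattern_cases incG nup ndown.
have cls d Omega P xi (iid : @iid_seq R d Omega P k p xi) :
    rds_class P c (transf s r fs) (invfam (transf s r fs)) xi.
  apply: (rds_class_of_pattern iid) => //; first exact: transf_increasing.
  exact: transf_both_ways.
exists s, r, c; split => //; split=> [//|d Omega P xi c' iid].
exact: (rds_class_unique iid (cls _ _ _ _ iid)).
Qed.
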